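(* Let $n,k\ge 1$ be integers and let $G_{2n}(k+1)$ be the simple graph with vertex set $$\{u_i, v_i : 1\le i\le 2k+1\}\cup\{y_{i,j}, z_{i,j} : 1\le i\le k,\ 1\le j\le 2n\}\cup\{x_{k+1,j} : 1\le j\le 2n\}$$ and edge set consisting of - $u_iv_i$ for $1\le i\le 2k+1$; - $u_iy_{i,j}$, $v_{2k+2-i}y_{i,j}$, $v_iz_{i,j}$, $u_{2k+2-i}z_{i,j}$ for $1\le i\le k$ and $1\le j\le 2n$; - $u_{k+1}x_{k+1,j}$, $v_{k+1}x_{k+1,j}$ for $1\le j\le 2n$. This graph has $k+1$ components: $k$ of them are the graphs on $\{u_i,v_i,u_{2k+2-i},v_{2k+2-i},y_{i,j},z_{i,j}\}$, and the remaining one is a copy of $P_2\vee O_{2n}$. Then $\chi_{la}(G_{2n}(k+1))=3$.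
   Context: For a graph $G$ with $q$ edges, a local antimagic labeling is a bijection $f:E(G)\to\{1,2,\dots,q\}$ such that $f^+(u)\ne f^+(v)$ for every edge $uv\in E(G)$. Here $f^+(u)=\sum_{e\ni u} f(e)$ is the sum of the labels of the edges incident to $u$. The color number of $f$ is the number of distinct values of $f^+$. The local antimagic chromatic number $\chi_{la}(G)$ is the minimum color number over all local antimagic labelings of $G$. $P_2\vee O_m$ denotes the join of an edge with an edgeless graph on $m$ vertices. *)

(* Defs.v *)
From HB Require Import structures.
From mathcomp Require Import all_boot.

Set Implicit Arguments.
Unset Strict Implicit.
Unset Printing Implicit Defensive.

Record sgraph := SGraph {
  vert :> finType;
  adj : rel vert;
  adj_sym : symmetric adj;
  adj_irr : irreflexive adj
}.

Definition edges (G : sgraph) : {set {set G}} :=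
  [set [set p.1; p.2] | p : G * G & adj p.1 p.2].

(* A labeling is a function on all sets of vertices; only its values on
   [edges G] are ever used. *)
Definition edge_bijection (G : sgraph) (f : {set G} -> nat) : Prop :=
  [/\ {in edges G &, injective f},
      forall e, e \in edges G -> 1 <= f e <= #|edges G|
    & forall l, 1 <= l <= #|edges G| -> exists2 e, e \in edges G & f e = l].

Definition induced_color (G : sgraph) (f : {set G} -> nat) (u : G) : nat :=
  \sum_(e in edges G | u \in e) f e.

Definition local_antimagic (G : sgraph) (f : {set G} -> nat) : Prop :=
  edge_bijection f /\
  forall u v : G, adj u v -> induced_color f u != induced_color f v.

Definition color_number (G : sgraph) (f : {set G} -> nat) : nat :=
  size (undup [seq induced_color f u | u : G]).

(* [chi_la_is G c] is the equation chi_la(G) = c, with the minimum stated as a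
   relation because a graph (such as P_2) may have no local antimagic
   labeling. *)
Definition chi_la_is (G : sgraph) (c : nat) : Prop :=
  (exists2 f : {set G} -> nat, local_antimagic f & color_number f = c) /\
  (forall f : {set G} -> nat, local_antimagic f -> c <= color_number f).

(* The components of a graph, as sets of vertices. *)
Definition components (G : sgraph) : {set {set G}} :=
  [set [set y | connect (@adj G) x y] | x : G].

Definition isomorphic (G H : sgraph) : Prop :=
  exists2 h : G -> H, bijective h & forall x y, adj (h x) (h y) = adj x y.

Section Induced.
Variables (G : sgraph) (S : {set G}).

Definition induced_adj : rel {x : G | x \in S} :=
  fun x y => adj (val x) (val y).

Fact induced_sym : symmetric induced_adj.
Proof. by move=> x y; apply: adj_sym. Qed.

Fact induced_irr : irreflexive induced_adj.
Proof. by move=> x; apply: adj_irr. Qed.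

Definition induced : sgraph := SGraph induced_sym induced_irr.
End Induced.

Section Path.
Variable m : nat.

Definition path_adj : rel 'I_m := fun i j => (i.+1 == j) || (j.+1 == i).

Fact path_sym : symmetric path_adj.
Proof. by move=> i j; apply: orbC. Qed.

Fact path_irr : irreflexive path_adj.
Proof. by move=> i; rewrite /path_adj orbb gtn_eqF. Qed.

Definition path_graph : sgraph := SGraph path_sym path_irr.
End Path.

Section Edgeless.
Variable m : nat.

Definition edgeless_adj : rel 'I_m := fun _ _ => false.

Fact edgeless_sym : symmetric edgeless_adj.
Proof. by []. Qed.

Fact edgeless_irr : irreflexive edgeless_adj.
Proof. by []. Qed.

Definition edgeless : sgraph := SGraph edgeless_sym edgeless_irr.
End Edgeless.

Section Join.
Variables G H : sgraph.

Definition join_adj : rel (G + H)%type := fun a b =>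
  match a, b with
  | inl x, inl y => adj x y
  | inr x, inr y => adj x y
  | _, _ => true
  end.

Fact join_sym : symmetric join_adj.
Proof. by move=> [x|x] [y|y] //=; apply: adj_sym. Qed.

Fact join_irr : irreflexive join_adj.
Proof. by move=> [x|x] /=; apply: adj_irr. Qed.

Definition join : sgraph := SGraph join_sym join_irr.
End Join.

(* Indices are shifted to start from 0: [U i] is u_{i+1}, [Y i j] is
   y_{i+1,j+1}, and [X j] is x_{k+1,j+1}. *)
Inductive vertex (n k : nat) :=
  | U of 'I_(2 * k + 1)
  | V of 'I_(2 * k + 1)
  | Y of 'I_k & 'I_(2 * n)
  | Z of 'I_k & 'I_(2 * n)
  | X of 'I_(2 * n).
Arguments U {n k}.
Arguments V {n k}.
Arguments Y {n k}.
Arguments Z {n k}.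
Arguments X {n k}.

Section VertexFinType.
Variables n k : nat.

Definition vertex_code : Type :=
  'I_(2 * k + 1) + ('I_(2 * k + 1) +
    ('I_k * 'I_(2 * n) + ('I_k * 'I_(2 * n) + 'I_(2 * n)))).

Definition encode (a : vertex n k) : vertex_code :=
  match a with
  | U i => inl i
  | V i => inr (inl i)
  | Y i j => inr (inr (inl (i, j)))
  | Z i j => inr (inr (inr (inl (i, j))))
  | X j => inr (inr (inr (inr j)))
  end.

Definition decode (c : vertex_code) : vertex n k :=
  match c with
  | inl i => U i
  | inr (inl i) => V i
  | inr (inr (inl p)) => Y p.1 p.2
  | inr (inr (inr (inl p))) => Z p.1 p.2
  | inr (inr (inr (inr j))) => X j
  end.

Fact encodeK : cancel encode decode.
Proof. by case. Qed.

HB.instance Definition _ :=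
  Finite.copy (vertex n k) (can_type encodeK).
End VertexFinType.

Section Gk.
Variables n k : nat.

(* Each edge oriented as in the defining list. *)
Definition arc (a b : vertex n k) : bool :=
  match a, b with
  | U i, V i' => i' == i
  | U i, Y p _ => i.+1 == p.+1
  | V i, Y p _ => i.+1 == 2 * k + 2 - p.+1
  | V i, Z p _ => i.+1 == p.+1
  | U i, Z p _ => i.+1 == 2 * k + 2 - p.+1
  | U i, X _ => i.+1 == k + 1
  | V i, X _ => i.+1 == k + 1
  | _, _ => false
  end.

Definition G_adj : rel (vertex n k) := fun a b => arc a b || arc b a.

Fact G_sym : symmetric G_adj.
Proof. by move=> a b; apply: orbC. Qed.

Fact G_irr : irreflexive G_adj.
Proof. by case. Qed.

(* The graph G_{2n}(k+1). *)
Definition G_2n : sgraph := SGraph G_sym G_irr.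

(* The vertices u_i, v_i, u_{2k+2-i}, v_{2k+2-i}, y_{i,j}, z_{i,j}, with i the
   1-based index p + 1. *)
Definition block (p : 'I_k) : {set G_2n} :=
  [set a : vertex n k | match a with
    | U i | V i => (i.+1 == p.+1) || (i.+1 == 2 * k + 2 - p.+1)
    | Y p' _ | Z p' _ => p' == p
    | X _ => false
    end].

(* The vertices u_{k+1}, v_{k+1}, x_{k+1,j}. *)
Definition middle_block : {set G_2n} :=
  [set a : vertex n k | match a with
    | U i | V i => i.+1 == k + 1
    | Y _ _ | Z _ _ => false
    | X _ => true
    end].
End Gk.

(* Main.v *)
(* Put m = 2k+1 and q = m(4n+1), and count labels from 0 to q-1.  In every row
   i the graph is u_i v_i together with 2n vertices w_{i,j} joined to u_i and
   to v_{m-1-i}.  Give the edges u_i w_{i,j} the labels b_{i,j} < 2nm, the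
   edges v_{m-1-i} w_{i,j} the complementary labels q-1-b_{i,j}, and u_i v_i
   the label 2nm+i.  Then all w_{i,j} have the same color, and all u_i (hence
   all v_i) do as soon as i + sum_j b_{i,j} does not depend on i.  This is
   achieved by filling column j with jm + (a permutation of 0..2k): two columns
   complete i to a magic rectangle, the remaining ones are paired as i and
   2k-i.  The triangles of the middle component require three colors. *)

Require Import Defs.
From mathcomp Require Import all_boot.
From mathcomp Require Import zify.

(** * Labelings of a general graph *)

(** The colors at the corners of a triangle are pairwise distinct. *)
Lemma three_le_color_number (G : sgraph) (f : {set G} -> nat) (a b c : G) :
  local_antimagic f -> adj a b -> adj b c -> adj a c -> 3 <= color_number f.
Proof.
move=> [_ fP] /fP ab /fP bc /fP ac.
pose s := [:: induced_color f a; induced_color f b; induced_color f c].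
apply: (@uniq_leq_size _ s).
  by rewrite /= !inE negb_or ab bc ac.
move=> x; rewrite mem_undup !inE.
by case/or3P => /eqP ->; apply: image_f.
Qed.

(** Reduces the construction of a labeling to labels on an index type, counted from 0; surjectivity
    onto the labels comes for free by counting. *)
Lemma labeling_of_parametrization (G : sgraph) (T : finType)
    (e : T -> {set G}) (lab : T -> nat) :
  injective e -> edges G = [set e t | t : T] ->
  injective lab -> (forall t, lab t < #|T|) ->
  exists2 f : {set G} -> nat, edge_bijection f &
    forall u, induced_color f u = \sum_(t | u \in e t) (lab t).+1.
Proof.
move=> e_inj edgesE lab_inj lab_lt.
(* The value 0 is a default for sets that are not edges. *)
pose f (A : {set G}) := if [pick t | e t == A] is Some t then (lab t).+1 else 0.
have fe t : f (e t) = (lab t).+1.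
  rewrite /f; case: pickP => [t' /eqP/e_inj -> //|/(_ t)]; by rewrite eqxx.
have card_edges : #|edges G| = #|T| by rewrite edgesE card_imset.
exists f; first split.
- rewrite edgesE => _ _ /imsetP[t _ ->] /imsetP[t' _ ->].
  by rewrite !fe => -[/lab_inj ->].
- by rewrite card_edges edgesE => _ /imsetP[t _ ->]; rewrite fe lab_lt.
- move=> [//|l] /andP[_]; rewrite card_edges => l_lt.
  pose g t : 'I_#|T| := Ordinal (lab_lt t).
  have g_inj : injective g by move=> t t' [] /lab_inj.
  have /codomP[t gt] : Ordinal l_lt \in codom g.
    by apply: inj_card_onto g_inj _ _; rewrite card_ord.
  exists (e t); first by rewrite edgesE imset_f.
  by rewrite fe -[lab t]/(val (g t)) -gt.
- move=> u; rewrite /induced_color edgesE big_imset_cond /=.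
    by apply: eq_bigr => t _; rewrite fe.
  by move=> ? ? _ _ /e_inj.
Qed.

(** * The magic rectangle *)

(* Rows 0, 1 and [i |-> i] form a magic rectangle: three permutations of
   0..2k whose sum is constantly 3k. *)
Definition magic (k j i : nat) : nat :=
  match j with
  | 0 => if i <= k then i + k else i - k.+1
  | 1 => if i <= k then 2 * k - 2 * i else 4 * k + 1 - 2 * i
  | _ => if odd j then 2 * k - i else i
  end.

Lemma magic_lt k j i : i < 2 * k + 1 -> magic k j i < 2 * k + 1.
Proof. by case: j => [|[|j]] /=; case: ifP; lia. Qed.

Lemma magic_inj k j i i' : i < 2 * k + 1 -> i' < 2 * k + 1 ->
  magic k j i = magic k j i' -> i = i'.
Proof.
case: j => [|[|j]] /=; last by case: ifP; lia.
  by case: ifP; case: ifP; lia.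
by case: ifP; case: ifP; lia.
Qed.

(** Induction on [n]: the first two columns together with [i] give [3 * k], and every further pair
    of columns adds [i + (2 * k - i)]. *)
Lemma sum_magic k i n : i < 2 * k + 1 -> 0 < n ->
  \sum_(j < 2 * n) magic k j i + i = (2 * n + 1) * k.
Proof.
move=> i_lt; elim: n => [//|[|n] IH _].
  by rewrite !big_ord_recr big_ord0 /=; case: ifP; lia.
have -> : 2 * n.+2 = (2 * n).+4 by lia.
have {IH} := IH isT; have -> : 2 * n.+1 = (2 * n).+2 by lia.
rewrite [in X in _ -> X]big_ord_recr [in X in _ -> X]big_ord_recr.
set s := bigop _ _ _.
rewrite [magic k (widen_ord _ _) i]/= [magic k ord_max i]/= !negbK mul2n odd_double /=.
lia.
Qed.

Definition cell (k j i : nat) : nat := j * (2 * k + 1) + magic k j i.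

Lemma cell_lt n k j i : j < 2 * n -> i < 2 * k + 1 ->
  cell k j i < 2 * n * (2 * k + 1).
Proof. by move=> ? /(magic_lt k j); rewrite /cell; nia. Qed.

(** [j] and [magic k j i] are the quotient and the remainder of the cell modulo [2 * k + 1]. *)
Lemma cell_inj k j j' i i' : i < 2 * k + 1 -> i' < 2 * k + 1 ->
  cell k j i = cell k j' i' -> j = j' /\ i = i'.
Proof.
move=> i_lt i'_lt eq_cell.
have := magic_lt k j i i_lt; have := magic_lt k j' i' i'_lt.
move: eq_cell; rewrite /cell => eq_cell lt lt'.
have eq_j : j = j' by nia.
by subst j'; split=> //; apply: (magic_inj k j) => //; lia.
Qed.

Lemma sum_cell n k i : 0 < n -> i < 2 * k + 1 ->
  \sum_(j < 2 * n) cell k j i + i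
    = (2 * n + 1) * k + n * (2 * n - 1) * (2 * k + 1).
Proof.
move=> n_gt0 i_lt; rewrite big_split /= addnAC -addnA addnC -big_distrl /=.
congr addn; first by rewrite addnC sum_magic.
congr muln; rewrite -(big_mkord xpredT (fun j => j)) bin2_sum bin2 mul2n.
by rewrite -doubleMl doubleK; congr muln; lia.
Qed.

(** * Rows of vertices and enumeration of the edges *)

Lemma U_inj n k : injective (@U n k).
Proof. by move=> i i' []. Qed.

Lemma V_inj n k : injective (@V n k).
Proof. by move=> i i' []. Qed.

(* The vertices [Y], [X] and [Z] stacked in rows 0..2k, so that [W i j] is
   joined to [U i] and to [V (rev_ord i)] in every row. *)
Definition W {n k : nat} (i : 'I_(2 * k + 1)) (j : 'I_(2 * n)) : vertex n k :=
  if insub (i : nat) is Some p then Y p j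
  else if insub (2 * k - i) is Some p then Z p j else X j.

Variant W_view {n k : nat} (i : 'I_(2 * k + 1)) (j : 'I_(2 * n)) :
    vertex n k -> Type :=
  | WY (p : 'I_k) of i = p :> nat : W_view i j (Y p j)
  | WZ (p : 'I_k) of i = 2 * k - p :> nat : W_view i j (Z p j)
  | WX of i = k :> nat : W_view i j (X j).

Lemma WP n k i j : W_view i j (@W n k i j).
Proof.
rewrite /W; case: insubP => [p _ /= p_def|i_ge]; first by apply: WY.
by case: insubP => [p _ /= p_def|i_le]; [apply: WZ | apply: WX]; have := ltn_ord i; lia.
Qed.

Lemma W_eqE n k i j i' j' :
  (@W n k i j == W i' j') = (i == i') && (j == j').
Proof.
apply/eqP/andP => [|[/eqP -> /eqP -> //]].
case: (WP _ _ i j) => [p ip|p ip|ip]; case: (WP _ _ i' j') => [q iq|q iq|iq] //.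
- by move=> [pq ->]; split=> //; apply/eqP/val_inj; rewrite /= ip iq pq.
- by move=> [pq ->]; split=> //; apply/eqP/val_inj; rewrite /= ip iq pq.
- by move=> [->]; split=> //; apply/eqP/val_inj; rewrite /= ip iq.
Qed.

Lemma W_neqU n k i j i' : (@W n k i j == U i') = false.
Proof. by apply/eqP; case: WP. Qed.

Lemma W_neqV n k i j i' : (@W n k i j == V i') = false.
Proof. by apply/eqP; case: WP. Qed.

Variant vertex_view {n k : nat} : vertex n k -> Type :=
  | isU i : vertex_view (U i)
  | isV i : vertex_view (V i)
  | isW i j : vertex_view (W i j).

Lemma vertexP n k (a : vertex n k) : vertex_view a.
Proof.
case: a => [i|i|p j|p j|j]; [exact: isU | exact: isV | | |].
- have p_lt : p < 2 * k + 1 by have := ltn_ord p; lia.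
  suff -> : Y p j = W (Ordinal p_lt) j by exact: isW.
  case: WP => [q|q|] /= pq; [| have := ltn_ord q; have := ltn_ord p; lia
                             | have := ltn_ord p; lia].
  by congr Y; apply: val_inj.
- have p_lt : 2 * k - p < 2 * k + 1 by lia.
  suff -> : Z p j = W (Ordinal p_lt) j by exact: isW.
  case: WP => [q|q|] /= pq; have := ltn_ord p; [have := ltn_ord q; lia | | lia].
  by move=> p_k; congr Z; apply: val_inj; have := ltn_ord q; rewrite /=; lia.
- have k_lt : k < 2 * k + 1 by lia.
  suff -> : X j = W (Ordinal k_lt) j by exact: isW.
  by case: WP => [q|q|] //= kq; have := ltn_ord q; lia.
Qed.

Definition arc_index (n k : nat) : finType :=
  ('I_(2 * k + 1) + ('I_(2 * k + 1) * 'I_(2 * n)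
                     + 'I_(2 * k + 1) * 'I_(2 * n)))%type.

Definition arc_of {n k : nat} (t : arc_index n k) : vertex n k * vertex n k :=
  match t with
  | inl i => (U i, V i)
  | inr (inl p) => (U p.1, W p.1 p.2)
  | inr (inr p) => (V (rev_ord p.1), W p.1 p.2)
  end.

Lemma arc_of_inj n k : injective (@arc_of n k).
Proof.
move=> [i|[[i j]|[i j]]] [i'|[[i' j']|[i' j']]] //= [].
- by move=> ->.
- by move=> _ /eqP; rewrite eq_sym W_neqV.
- by move=> _ /eqP; rewrite W_neqV.
- by move=> _ /eqP; rewrite W_eqE => /andP[/eqP -> /eqP ->].
- by move=> _ /eqP; rewrite W_eqE => /andP[/eqP -> /eqP ->].
Qed.

(** Counting from 0, [Y p j] is joined to [U] at [p] and [V] at [2 * k - p], [Z p j] to [U] at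
    [2 * k - p] and [V] at [p], and [X j] to both at [k]: one rule for all rows. *)
Lemma arcE n k (a b : vertex n k) :
  reflect (exists t, arc_of t = (a, b)) (Defs.arc a b).
Proof.
apply: (iffP idP) => [|[[i|[[i j]|[i j]]] [<- <-]] /=]; first last.
- by case: WP => [p|p|] /=; have := ltn_ord i; try (have := ltn_ord p); lia.
- by case: WP => [p|p|] /=; have := ltn_ord i; try (have := ltn_ord p); lia.
- by rewrite /= eqxx.
case: (vertexP _ _ a) => [i|i|i j]; case: (vertexP _ _ b) => [i'|i'|i' j'] //=.
- by move=> /eqP ->; exists (inl i).
- move=> H; have {H} -> : i = i'.
    apply: val_inj; move: H; case: WP => [p|p|] /=;
      have := ltn_ord i; try (have := ltn_ord p); lia.
  by exists (inr (inl (i', j'))).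
- move=> H; have {H} -> : i = rev_ord i'.
    apply: val_inj; move: H; case: WP => [p|p|] /=;
      have := ltn_ord i; try (have := ltn_ord p); lia.
  by exists (inr (inr (i', j'))).
- by case: WP.
- by case: WP.
- by case: (WP _ _ i j) => [?|?|]; case: WP.
Qed.

Lemma arc_asym n k (a b : vertex n k) : Defs.arc a b -> Defs.arc b a = false.
Proof. by case: a; case: b. Qed.

Definition edge_of {n k : nat} (t : arc_index n k) : {set G_2n n k} :=
  [set (arc_of t).1; (arc_of t).2].

(** No arc is also an arc when reversed, so the unordered pair determines the oriented one. *)
Lemma edge_of_inj n k : injective (@edge_of n k).
Proof.
move=> s t eq_st; apply: arc_of_inj.
have : Defs.arc (arc_of s).1 (arc_of s).2 by apply/arcE; exists s; case: arc_of.
have : Defs.arc (arc_of t).1 (arc_of t).2 by apply/arcE; exists t; case: arc_of.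
move: eq_st; rewrite /edge_of.
case: (arc_of s) (arc_of t) => [a b] [c d] /= eq_set arc_cd arc_ab.
have := set21 a b; have := set22 a b; rewrite eq_set !inE.
case/orP=> /eqP eb /orP[] /eqP ea; subst a b => //; have := arc_asym _ _ _ _ arc_ab.
- by rewrite arc_ab.
- by rewrite arc_cd.
- by rewrite arc_ab.
Qed.

Lemma edges_G n k : edges (G_2n n k) = [set edge_of t | t : arc_index n k].
Proof.
apply/setP => e; apply/imsetP/imsetP => [[[a b]]|[t _ ->]].
  rewrite inE /= => /orP[] /arcE[t tE] ->; exists t => //; rewrite /edge_of tE //=.
  by rewrite setUC.
exists (arc_of t) => //; rewrite inE /= /G_adj.
by apply/orP; left; apply/arcE; exists t; case: arc_of.
Qed.

Lemma mem_edge_of n k (a : vertex n k) (t : arc_index n k) :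
  (a \in edge_of t) = (a == (arc_of t).1) || (a == (arc_of t).2).
Proof. by rewrite !inE. Qed.

(** * Sums over the edges at a vertex *)

Lemma sum_edges_U n k (F : arc_index n k -> nat) (i : 'I_(2 * k + 1)) :
  \sum_(t | (U i : G_2n n k) \in edge_of t) F t
    = F (inl i) + \sum_(j < 2 * n) F (inr (inl (i, j))).
Proof.
rewrite !big_sumType /=; congr addn.
  apply: big_pred1 => i'; rewrite mem_edge_of /= (inj_eq (@U_inj n k)).
  by rewrite orbF eq_sym.
rewrite [X in _ + X]big1 ?addn0 => [|[i' j] ]; last first.
  by rewrite mem_edge_of /= [U i == W _ _]eq_sym W_neqU.
rewrite (reindex_onto (fun j => (i, j)) snd) /=.
  by apply: eq_bigl => j; rewrite mem_edge_of /= !eqxx.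
move=> [i' j]; rewrite mem_edge_of /= (inj_eq (@U_inj n k)).
by rewrite [U i == W _ _]eq_sym W_neqU orbF => /eqP ->.
Qed.

Lemma sum_edges_V n k (F : arc_index n k -> nat) (i : 'I_(2 * k + 1)) :
  \sum_(t | (V i : G_2n n k) \in edge_of t) F t
    = F (inl i) + \sum_(j < 2 * n) F (inr (inr (rev_ord i, j))).
Proof.
rewrite !big_sumType /=; congr addn.
  apply: big_pred1 => i'; rewrite mem_edge_of /= (inj_eq (@V_inj n k)).
  by rewrite eq_sym.
rewrite [X in X + _]big1 ?add0n => [|[i' j] ]; last first.
  by rewrite mem_edge_of /= [V i == W _ _]eq_sym W_neqV.
rewrite (reindex_onto (fun j => (rev_ord i, j)) snd) /=.
  by apply: eq_bigl => j; rewrite mem_edge_of /= rev_ordK !eqxx.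
move=> [i' j]; rewrite mem_edge_of /= (inj_eq (@V_inj n k)).
by rewrite [V i == W _ _]eq_sym W_neqV orbF => /eqP ->; rewrite rev_ordK.
Qed.

Lemma sum_edges_W n k (F : arc_index n k -> nat) i j :
  \sum_(t | (W i j : G_2n n k) \in edge_of t) F t
    = F (inr (inl (i, j))) + F (inr (inr (i, j))).
Proof.
rewrite !big_sumType /= big1 ?add0n => [|i']; last first.
  by rewrite mem_edge_of /= W_neqU W_neqV.
by congr addn; apply: big_pred1 => -[i' j'];
  rewrite mem_edge_of /= ?W_neqU ?W_neqV W_eqE /= eq_sym [j == _]eq_sym.
Qed.

(** * The labeling and its three colors *)

Definition size_G (n k : nat) : nat := (2 * k + 1) * (4 * n + 1).

Lemma cell_lt_size n k j i : j < 2 * n -> i < 2 * k + 1 -> cell k j i < size_G n k.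
Proof. by move=> j_lt /(cell_lt n k j i j_lt); rewrite /size_G; lia. Qed.

Lemma card_arc_index n k : #|arc_index n k| = size_G n k.
Proof. by rewrite !card_sum !card_prod !card_ord /size_G; lia. Qed.

(* Labels are counted from 0: each pair of labels summing to [size_G n k - 1]
   is split between the two edges at some [W i j], and the remaining central
   labels go to the edges [U i]-[V i]. *)
Definition label {n k : nat} (t : arc_index n k) : nat :=
  match t with
  | inl i => 2 * n * (2 * k + 1) + i
  | inr (inl p) => cell k p.2 p.1
  | inr (inr p) => (size_G n k).-1 - cell k p.2 p.1
  end.

Lemma label_lt n k (t : arc_index n k) : label t < #|arc_index n k|.
Proof.
rewrite card_arc_index /size_G; case: t => [i|[[i j]|[i j]]] /=.
- by have := ltn_ord i; nia.
- by have := cell_lt n k j i (ltn_ord j) (ltn_ord i); nia.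
- by apply: leq_ltn_trans (leq_subr _ _) _; rewrite ltn_predL muln_gt0; lia.
Qed.

(** With [m = 2 * k + 1], the three kinds of edges take labels below [2nm], from [2nm] to
    [2nm + m - 1], and from [2nm + m] on, so only labels of the same kind need comparing. *)
Lemma label_inj n k : injective (@label n k).
Proof.
have lt_cell (i : 'I_(2 * k + 1)) (j : 'I_(2 * n)) :=
  cell_lt n k j i (ltn_ord j) (ltn_ord i).
have cellP (i i' : 'I_(2 * k + 1)) (j j' : 'I_(2 * n)) :
    cell k j i = cell k j' i' -> (i, j) = (i', j').
  move=> /cell_inj[] // jj ii.
  by congr pair; apply: val_inj.
move=> [i|[[i j]|[i j]]] [i'|[[i' j']|[i' j']]] /=; rewrite /size_G.
- by move=> /addnI/val_inj ->.
- by have := lt_cell i' j'; lia.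
- by have := lt_cell i' j'; have := ltn_ord i; nia.
- by have := lt_cell i j; lia.
- by move=> /cellP ->.
- by have := lt_cell i' j'; have := lt_cell i j; nia.
- by have := lt_cell i j; have := ltn_ord i'; nia.
- by have := lt_cell i' j'; have := lt_cell i j; nia.
- move=> eq_label; suff /cellP -> : cell k j i = cell k j' i' by [].
  by have := lt_cell i' j'; have := lt_cell i j; nia.
Qed.

(** The term [1 + 2 * n] is the degree of [U i], coming from the shift of each label by one; the
    last bracket is the constant of [sum_cell], which absorbs the [i] in the label of
    [U i]-[V i]. *)
Definition color_U (n k : nat) : nat :=
  2 * n * (2 * k + 1) + 1 + 2 * n
    + ((2 * n + 1) * k + n * (2 * n - 1) * (2 * k + 1)).

Definition color_W (n k : nat) : nat := (size_G n k).+1.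

(* The subtraction does not truncate, by [color_U_V]. *)
Definition color_V (n k : nat) : nat :=
  (2 * n + 1) * color_W n k - color_U n k.

Lemma sum_label_U n k (i : 'I_(2 * k + 1)) : 0 < n ->
  \sum_(t | (U i : G_2n n k) \in edge_of t) (label t).+1 = color_U n k.
Proof.
move=> n_gt0; rewrite sum_edges_U /=.
under eq_bigr do rewrite -addn1.
rewrite big_split /= sum_nat_const card_ord muln1.
have := sum_cell n k i n_gt0 (ltn_ord i); rewrite /color_U.
by move: (\sum_(j < 2 * n) cell k j i) => s; lia.
Qed.

(** The cells of row [rev_ord i] sum to a constant minus [2 * k - i]. Complementing changes the
    sign, so the resulting [- i] cancels the [i] in the label of [U i]-[V i]. *)
Lemma sum_label_V n k (i : 'I_(2 * k + 1)) : 0 < n ->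
  \sum_(t | (V i : G_2n n k) \in edge_of t) (label t).+1 = color_V n k.
Proof.
move=> n_gt0; rewrite sum_edges_V /=.
set s := \sum_(_ < _) _.
have : s + \sum_(j < 2 * n) cell k j (rev_ord i) = 2 * n * size_G n k.
  rewrite -big_split /= -[in RHS](card_ord (2 * n)) -sum_nat_const.
  apply: eq_bigr => j _.
  by have := cell_lt_size n k j _ (ltn_ord j) (ltn_ord (rev_ord i)) => /=; lia.
have := sum_cell n k _ n_gt0 (ltn_ord (rev_ord i)).
have := ltn_ord i.
rewrite /color_V; move: (\sum_(j < 2 * n) _) => c i_lt sum_c sum_s.
(* Adding [color_U] to both sides removes the subtraction in [color_V]. *)
rewrite -[LHS](addnK (color_U n k)); congr subn.
move: sum_c sum_s; rewrite /color_U /color_W /size_G /=.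
move: ((2 * n + 1) * k + _) s => K s; lia.
Qed.

Lemma sum_label_W n k i j :
  \sum_(t | (W i j : G_2n n k) \in edge_of t) (label t).+1 = color_W n k.
Proof.
rewrite sum_edges_W /=.
by have := cell_lt_size n k j i (ltn_ord j) (ltn_ord i); rewrite /color_W; lia.
Qed.

(** Equivalently, [color_V] exceeds [color_U] by [(2 * n + 1) * (2 * n * (2 * k + 1))], which is
    positive. *)
Lemma color_U_V n k : 0 < n ->
  2 * color_U n k + (2 * n + 1) * (2 * n * (2 * k + 1)) = (2 * n + 1) * color_W n k.
Proof.
rewrite /color_U /color_W /size_G; case: n => // n _.
have -> : 2 * n.+1 - 1 = 2 * n + 1 by lia.
lia.
Qed.

Lemma colors_uniq n k : 0 < n -> 0 < k ->
  uniq [:: color_U n k; color_V n k; color_W n k].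
Proof.
move=> n_gt0 k_gt0; have := color_U_V n k n_gt0.
(* For [n = 1] the two colors are [9 * k + 6] and [10 * k + 6], distinct since [0 < k]; for
   [n >= 2], [color_U] is the larger. *)
have U_neq_W : 2 * color_U n k <> 2 * color_W n k.
  rewrite /color_U /color_W /size_G; case: n n_gt0 => [//|[|n]] _; first by lia.
  have -> : 2 * n.+2 - 1 = 2 * n + 3 by lia.
  lia.
have W_gt0 : 0 < color_W n k by [].
have nk_gt0 : 0 < (2 * n + 1) * (2 * n * (2 * k + 1)) by rewrite !muln_gt0; lia.
rewrite /= !inE negb_or /color_V => UV.
(* Equality of [color_V] and [color_W] would mean [color_U = 2n * color_W], whereas [UV] gives [2 *
   color_U < (2n + 1) * color_W <= 4n * color_W]. *)
have V_neq_W : 2 * n * color_W n k <> color_U n k.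
  by move: UV W_gt0; case: n n_gt0 nk_gt0 {U_neq_W} => // n _; nia.
lia.
Qed.

(** * The local antimagic chromatic number *)

Lemma color_number_G_ge3 n k (f : {set G_2n n k} -> nat) : 0 < n ->
  local_antimagic f -> 3 <= color_number f.
Proof.
case: n f => // n f _ f_la.
have k_lt : k < 2 * k + 1 by lia.
have j_lt : 0 < 2 * n.+1 by lia.
apply: (three_le_color_number (G_2n n.+1 k) f (U (Ordinal k_lt))
  (V (Ordinal k_lt)) (X (Ordinal j_lt)) f_la).
all: by rewrite /= /G_adj /= ?eqxx ?addn1 ?eqxx.
Qed.

Lemma chi_la_G n k : 0 < n -> 0 < k -> chi_la_is (G_2n n k) 3.
Proof.
move=> n_gt0 k_gt0; split=> [|f]; last exact: color_number_G_ge3.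
have [f f_bij f_color] := labeling_of_parametrization (G_2n n k) _ _ _
  (@edge_of_inj n k) (edges_G n k) (@label_inj n k) (@label_lt n k).
have colorU i : induced_color f (U i : G_2n n k) = color_U n k.
  by rewrite f_color sum_label_U.
have colorV i : induced_color f (V i : G_2n n k) = color_V n k.
  by rewrite f_color sum_label_V.
have colorW i j : induced_color f (W i j : G_2n n k) = color_W n k.
  by rewrite f_color sum_label_W.
have := colors_uniq n k n_gt0 k_gt0; rewrite /= !inE negb_or andbT.
case/andP => /andP[UV UW] VW.
have f_arc a b : Defs.arc a b ->
    induced_color f (a : G_2n n k) != induced_color f (b : G_2n n k).
  by move=> /arcE[[i|[[i j]|[i j]]] [<- <-]];
     rewrite ?colorU ?colorV ?colorW.
have f_la : local_antimagic f.
  split=> // a b /orP[] /f_arc //; by rewrite eq_sym.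
exists f => //; apply/eqP; rewrite eqn_leq color_number_G_ge3 // andbT.
apply: (@uniq_leq_size _ _ [:: color_U n k; color_V n k; color_W n k]).
  exact: undup_uniq.
move=> c; rewrite mem_undup => /imageP[a _ ->].
by case: (vertexP _ _ a) => [i|i|i j];
   rewrite ?colorU ?colorV ?colorW !inE eqxx ?orbT.
Qed.

(** * Connected components *)

(** A numbering of the components: rows [i] and [2 * k - i] are folded together, and the fixed row
    [k] is the middle component. *)
Definition block_index {n k : nat} (a : vertex n k) : nat :=
  match a with
  | U i | V i => minn i (2 * k - i)
  | Y p _ | Z p _ => p
  | X _ => k
  end.

Lemma block_index_le n k (a : vertex n k) : block_index a <= k.
Proof. by case: a => [i|i|p j|p j|j] /=; try (have := ltn_ord p); lia. Qed.

Lemma block_index_adj n k (a b : vertex n k) :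
  G_adj a b -> block_index a = block_index b.
Proof.
have arcP (c d : vertex n k) : Defs.arc c d -> block_index c = block_index d.
  case: c d => [i|i|p j|p j|j] [i'|i'|p' j'|p' j'|j'] //=;
    try (have := ltn_ord p'); try lia.
  by move=> /eqP ->.
by move=> /orP[] /arcP.
Qed.

Lemma connect_block_index n k (a b : G_2n n k) :
  connect (@adj (G_2n n k)) a b -> block_index a = block_index b.
Proof.
case/connectP => p; elim: p a => [a _ -> //|c p IH a /= /andP[ac cp] b_def].
by rewrite (block_index_adj _ _ _ _ ac); apply: IH.
Qed.

(** [U i] with [i <= k] serves as the representative of its component. *)
Lemma connect_to_U n k (a : G_2n n k) (i : 'I_(2 * k + 1)) : 0 < n ->
  block_index a = i -> connect (@adj (G_2n n k)) a (U i).
Proof.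
move=> n_gt0; have j_lt : 0 < 2 * n by lia.
have step (c b d : G_2n n k) : adj c b ->
    connect (@adj (G_2n n k)) b d -> connect (@adj (G_2n n k)) c d.
  by move=> /connect1; apply: connect_trans.
have U_low (i' : 'I_(2 * k + 1)) : i' = i :> nat ->
    connect (@adj (G_2n n k)) (U i') (U i).
  by move=> /val_inj ->.
have V_low (i' : 'I_(2 * k + 1)) : i' = i :> nat ->
    connect (@adj (G_2n n k)) (V i') (U i).
  by move=> /val_inj ->; apply: connect1; rewrite /= /G_adj /= eqxx.
have Z_to (p : 'I_k) j : p = i :> nat -> connect (@adj (G_2n n k)) (Z p j) (U i).
  by move=> pi; apply: (step _ (V i)) (V_low i erefl); rewrite /= /G_adj /=; lia.
have U_to (i' : 'I_(2 * k + 1)) : minn i' (2 * k - i') = i ->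
    connect (@adj (G_2n n k)) (U i') (U i).
  move=> i'i; have [i'_le|i'_gt] := leqP i' k; first by apply: U_low; lia.
  have i_lt : i < k by have := ltn_ord i'; lia.
  (* The path from row [2 * k - i] to row [i] runs through [Z i 0] and [V i]; column 0 exists
     because [0 < n]. *)
  apply: (step _ (Z (Ordinal i_lt) (Ordinal j_lt))) (Z_to _ _ _) => //.
  by rewrite /= /G_adj /=; have := ltn_ord i'; lia.
case: a => [i'|i'|p j|p j|j] /= ai.
- exact: U_to.
- by apply: (step _ (U i')) (U_to i' ai); rewrite /= /G_adj /= eqxx.
- by apply: (step _ (U i)) (U_low i erefl); rewrite /= /G_adj /=; lia.
- exact: Z_to.
- by apply: (step _ (U i)) (U_low i erefl); rewrite /= /G_adj /=; lia.
Qed.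

Lemma connectE n k (a b : G_2n n k) : 0 < n ->
  connect (@adj (G_2n n k)) a b = (block_index a == block_index b).
Proof.
move=> n_gt0; apply/idP/eqP => [|ab]; first exact: connect_block_index.
have i_lt : block_index a < 2 * k + 1 by have := block_index_le _ _ a; lia.
apply: (@connect_trans _ _ (U (Ordinal i_lt))); first exact: connect_to_U.
rewrite (sym_connect_sym (@adj_sym (G_2n n k))); exact: connect_to_U.
Qed.

Lemma blockE n k (p : 'I_k) :
  block n p = [set a : G_2n n k | block_index a == p].
Proof.
apply/setP => a; rewrite !inE; have := ltn_ord p.
by case: a => [i|i|q j|q j|j] //=; try (have := ltn_ord i); lia.
Qed.

Lemma middle_blockE n k :
  middle_block n k = [set a : G_2n n k | block_index a == k].
Proof.
apply/setP => a; rewrite !inE.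
case: a => [i|i|q j|q j|j] /=; try (have := ltn_ord i); try (have := ltn_ord q);
  lia.
Qed.

Lemma components_G n k : 0 < n ->
  components (G_2n n k)
    = [set [set a : G_2n n k | block_index a == t] | t : 'I_k.+1].
Proof.
move=> n_gt0; apply/setP => A; apply/imsetP/imsetP => [[a _ ->]|[t _ ->]].
  have a_lt : block_index a < k.+1 by rewrite ltnS block_index_le.
  exists (Ordinal a_lt) => //.
  by apply/setP => b; rewrite !inE connectE // eq_sym.
have t_lt : t < 2 * k + 1 by have := ltn_ord t; lia.
exists (U (Ordinal t_lt)) => //; apply/setP => b; rewrite !inE connectE // eq_sym.
by congr (_ == _); rewrite /=; have := ltn_ord t; lia.
Qed.

(** [U t] has block index [t] for [t <= k], so distinct indices give distinct blocks. *)
Lemma card_components_G n k : 0 < n -> #|components (G_2n n k)| = k.+1.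
Proof.
move=> n_gt0; rewrite components_G // card_imset ?card_ord // => s t /setP eq_st.
have s_lt : s < 2 * k + 1 by have := ltn_ord s; lia.
have := eq_st (U (Ordinal s_lt)); rewrite !inE /=.
have -> : minn s (2 * k - s) = s by have := ltn_ord s; lia.
by rewrite eqxx => /esym/eqP/val_inj.
Qed.

Lemma components_G_blocks n k : 0 < n ->
  components (G_2n n k) = middle_block n k |: [set block n p | p : 'I_k].
Proof.
move=> n_gt0; rewrite components_G // middle_blockE.
apply/setP => A; rewrite !inE; apply/imsetP/orP => [[t _ ->]|[/eqP ->|/imsetP[p _ ->]]].
- have [t_lt|t_ge] := ltnP t k; [right|left].
    by apply/imsetP; exists (Ordinal t_lt); rewrite // blockE.
  by have -> : t = k :> nat by have := ltn_ord t; lia.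
- by exists ord_max.
- by exists (widen_ord (leqnSn k) p); rewrite // blockE.
Qed.

(** * The middle component as a join *)

Lemma middle_block_iso n k :
  isomorphic (induced (middle_block n k))
    (join (path_graph 2) (edgeless (2 * n))).
Proof.
have k_lt : k < 2 * k + 1 by lia.
pose mid := Ordinal k_lt.
(* The last branch serves [U]; [Y] and [Z] fall there too but do not lie in the middle block. *)
pose to_join (a : induced (middle_block n k)) :
    join (path_graph 2) (edgeless (2 * n)) :=
  match val a with
  | X j => inr j
  | V _ => inl (ord_max : 'I_2)
  | _ => inl (ord0 : 'I_2)
  end.
pose of_join (c : join (path_graph 2) (edgeless (2 * n))) : vertex n k :=
  match c with
  | inl i => if i == 0 :> nat then U mid else V mid
  | inr j => X j
  end.
have of_join_mid c : of_join c \in middle_block n k.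
  by rewrite inE; case: c => [[[|i] i_lt]|j] //=; rewrite addn1.
have ord_mid (i : 'I_(2 * k + 1)) : i.+1 == k + 1 -> i = mid.
  by move=> i_k; apply: val_inj => /=; lia.
exists to_join.
  exists (fun c => exist _ (of_join c) (of_join_mid c)) => [[a a_mid]|c].
    apply: val_inj; rewrite /to_join /=.
    have : a \in middle_block n k by []; rewrite inE.
    by case: a {a_mid} => [i|i|p j|p j|j] //= /ord_mid ->.
  case: c => [[[|[|i]] i_lt]|j] //; rewrite /to_join /=; congr inl; exact: val_inj.
move=> [a a_mid] [b b_mid]; rewrite /to_join /= /induced_adj /= /G_adj.
move: a_mid b_mid; rewrite !inE.
case: a b => [i|i|p j|p j|j] [i'|i'|p' j'|p' j'|j'] //=.
all: move=> /= ii ii'; rewrite /path_adj -?val_eqE /=; lia.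
Qed.

Theorem theorem2p1 (n k : nat) (hn : 1 <= n) (hk : 1 <= k) :
  [/\ #|components (G_2n n k)| = k.+1,
      components (G_2n n k) = middle_block n k |: [set block n p | p : 'I_k],
      isomorphic (induced (middle_block n k)) (join (path_graph 2) (edgeless (2 * n)))
    & chi_la_is (G_2n n k) 3].
Proof.
split.
- exact: card_components_G.
- exact: components_G_blocks.
- exact: middle_block_iso.
- exact: chi_la_G.
Qed.
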